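(* Let $\Gamma$ be a connected, reduced, nonbipartite graph. Then there is a bijection $\psi_\Gamma$ from the family of conjugacy classes of $\mathrm{Aut}(\mathrm{B}\Gamma)$ consisting of strongly switching elements of $\Gamma$ onto the set of isomorphism classes of (simple, loopless) graphs two-fold isomorphic to $\Gamma$. Moreover, for every such conjugacy class $\mathcal{C}$, $|\mathcal{C}| = \mathrm{Inst}(\psi_\Gamma(\mathcal{C}))$.
   Context: Graphs are finite, simple, loopless; reduced means distinct vertices have distinct neighbourhoods. The canonical double cover $\mathrm{B}\Gamma=\Gamma\times K_2$ has vertex set $V\times\{0,1\}$ with $(u,i)\sim(v,j)$ iff $(u,v)\in E$ and $i\ne j$. An element $g\in\mathrm{Aut}(\mathrm{B}\Gamma)$ is a strongly switching element of $\Gamma$ if $g$ has order two, interchanges $V\times\{0\}$ and $V\times\{1\}$, and maps every vertex of $\mathrm{B}\Gamma$ to a vertex not adjacent to it. Graphs $\Gamma_1,\Gamma_2$ are two-fold isomorphic if there are bijections $\pi_1,\pi_2:V_1\to V_2$ with $(v,w)\in E_1\iff(\pi_1(v),\pi_2(w))\in E_2$. $\mathrm{Inst}(\Gamma')=|\mathrm{Aut}(\mathrm{B}\Gamma')|/(2|\mathrm{Aut}(\Gamma')|)$. *)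

(* Defs.v *)
From HB Require Import structures.
From mathcomp Require Import all_boot all_order all_algebra all_fingroup.

Set Implicit Arguments.
Unset Strict Implicit.
Unset Printing Implicit Defensive.

Import GRing.Theory.

Record sgraph := SGraph {
  vertex :> finType;
  adj : rel vertex;
  adj_sym : symmetric adj;
  adj_irrefl : irreflexive adj
}.

Definition nbhd (G : sgraph) (v : G) : {set G} := finset (adj v).

Definition connected (G : sgraph) : Prop :=
  forall v w : G, connect (@adj G) v w.

Definition reduced (G : sgraph) : Prop :=
  forall v w : G, v != w -> nbhd v != nbhd w.

Definition bipartite (G : sgraph) : Prop :=
  exists c : G -> bool, forall v w : G, adj v w -> c v != c w.

Definition isomorphic (G H : sgraph) : Prop :=
  exists f : G -> H, bijective f /\ forall v w : G, adj v w = adj (f v) (f w).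

Definition twofold_isomorphic (G H : sgraph) : Prop :=
  exists p1 p2 : G -> H,
    [/\ bijective p1, bijective p2 &
        forall v w : G, adj v w = adj (p1 v) (p2 w)].

Definition Aut_set (G : sgraph) : {set {perm G}} :=
  [set p : {perm G} | [forall v, forall w, adj (p v) (p w) == adj v w]]%SET.

Lemma Aut_setP (G : sgraph) (p : {perm G}) :
  reflect (forall v w, adj (p v) (p w) = adj v w) (p \in Aut_set G).
Proof.
rewrite inE; apply: (iffP forallP) => [H v w | H v].
  by apply/eqP; move/forallP: (H v).
by apply/forallP => w; apply/eqP.
Qed.

Lemma Aut_group_set (G : sgraph) : group_set (Aut_set G).
Proof.
apply/group_setP; split=> [|p q /Aut_setP Hp /Aut_setP Hq].
  by apply/Aut_setP => v w; rewrite !perm1.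
by apply/Aut_setP => v w; rewrite !permM Hq Hp.
Qed.

Definition Aut_graph (G : sgraph) : {group {perm G}} := Group (Aut_group_set G).

Section DoubleCover.
Variable G : sgraph.

Definition bdc_adj : rel (G * bool) :=
  fun x y => adj x.1 y.1 && (x.2 != y.2).

Lemma bdc_adj_sym : symmetric bdc_adj.
Proof. by move=> x y; rewrite /bdc_adj adj_sym eq_sym. Qed.

Lemma bdc_adj_irrefl : irreflexive bdc_adj.
Proof. by move=> x; rewrite /bdc_adj adj_irrefl. Qed.

(* The canonical double cover: [false] and [true] are the layers 0 and 1. *)
Definition bdc : sgraph := SGraph bdc_adj_sym bdc_adj_irrefl.

Definition layer (i : bool) : {set bdc} := [set x : bdc | x.2 == i]%SET.

Definition strongly_switching (g : {perm bdc}) : bool :=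
  [&& g \in Aut_graph bdc, #[g]%g == 2,
      g @: layer false == layer true, g @: layer true == layer false
    & [forall x, ~~ adj x (g x)]].

Definition strongly_switching_classes : {set {set {perm bdc}}} :=
  [set C in classes (Aut_graph bdc) | [forall g in C, strongly_switching g]]%SET.

End DoubleCover.

(* [sgraph] lives in too large a universe for [classical_sets.set], so a
   collection of graphs is a bare predicate, and a collection of isomorphism
   classes a predicate on predicates. *)
Definition iso_class (G : sgraph) : sgraph -> Prop := fun H => isomorphic G H.

Definition twofold_iso_classes (G : sgraph) (K : sgraph -> Prop) : Prop :=
  exists H : sgraph, twofold_isomorphic G H /\ K = iso_class H.

Definition bijection_onto (T : finType) (A : {set T})
    (B : (sgraph -> Prop) -> Prop) (f : T -> (sgraph -> Prop)) : Prop :=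
  [/\ forall x, x \in A -> B (f x),
      forall x y, x \in A -> y \in A -> f x = f y -> x = y
    & forall K, B K -> exists2 x, x \in A & f x = K].

Definition Inst (G : sgraph) : rat :=
  (#|Aut_graph (bdc G)|%:R / (2 * #|Aut_graph G|%:R))%R.

(* Main.v *)
(* A strongly switching g defines a graph on V by v ~ w iff (v,0) is adjacent
   to g (w,0) in the double cover.  As the double cover is connected, every
   automorphism preserves or exchanges its layers, so an isomorphism between two
   such graphs amounts to a layer-preserving automorphism conjugating the
   involutions.  A twofold isomorphism from the graph to H identifies the two
   double covers, and the layer swap of H pulls back to a strongly switching g
   whose graph is H.  Finally the layer-preserving elements commuting with g form
   a copy of the automorphism group of the graph of g, of index 2 (g exchanges
   the layers) in the centralizer of g; orbit-stabilizer gives the class size. *)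
Require Import Defs.
From mathcomp Require Import all_boot all_order all_algebra all_fingroup.
From mathcomp Require Import cyclic.
From Stdlib Require Import FunctionalExtensionality PropExtensionality.

Set Implicit Arguments.
Unset Strict Implicit.
Unset Printing Implicit Defensive.

Import GRing.Theory Num.Theory.

(** * Isomorphism classes and orders of automorphism groups *)

Lemma isomorphic_refl (G : sgraph) : isomorphic G G.
Proof. by exists id; split=> //; exists id. Qed.

Lemma isomorphic_sym (G H : sgraph) : isomorphic G H -> isomorphic H G.
Proof.
move=> [f [[f' fK f'K] Hf]]; exists f'; split; first by exists f.
by move=> v w; rewrite Hf !f'K.
Qed.

Lemma isomorphic_trans (G H K : sgraph) :
  isomorphic G H -> isomorphic H K -> isomorphic G K.
Proof.
move=> [f [bf Hf]] [h [bh Hh]]; exists (h \o f); split; first exact: bij_comp.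
by move=> v w; rewrite Hf Hh.
Qed.

(** [bijection_onto] compares classes by equality of predicates; the extensionality axioms reduce
    this to isomorphism. *)
Lemma iso_class_eq (G H : sgraph) :
  isomorphic G H <-> iso_class G = iso_class H.
Proof.
split=> [GH | E]; last first.
  by rewrite -/(iso_class G H) E; apply: isomorphic_refl.
apply: functional_extensionality => K; apply: propositional_extensionality.
split; last exact: isomorphic_trans.
by apply: isomorphic_trans; apply: isomorphic_sym.
Qed.

Lemma adj_Aut (G : sgraph) (p : {perm G}) :
  p \in Aut_graph G -> forall v w, adj (p v) (p w) = adj v w.
Proof. by move/Aut_setP. Qed.

(** Conjugation by the isomorphism embeds one automorphism group in the other. *)
Lemma leq_card_Aut (G H : sgraph) :
  isomorphic G H -> #|Aut_graph G| <= #|Aut_graph H|.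
Proof.
move=> [f [[f' fK f'K] Hf]].
have inj (p : {perm G}) : injective (fun x => f (p (f' x))).
  by move=> x y /(can_inj fK) /perm_inj /(can_inj f'K).
pose F p := perm (@inj p).
have Finj : injective F.
  move=> p q E; apply/permP => x; apply: (can_inj fK).
  by have := congr1 (fun s : {perm H} => s (f x)) E; rewrite !permE !fK.
rewrite -(card_imset _ Finj); apply: subset_leq_card; apply/subsetP => q.
case/imsetP=> p /Aut_setP Hp ->; apply/Aut_setP => v w.
by rewrite !permE -Hf Hp Hf !f'K.
Qed.

Lemma card_Aut_isomorphic (G H : sgraph) :
  isomorphic G H -> #|Aut_graph G| = #|Aut_graph H|.
Proof.
move=> GH; apply/eqP; rewrite eqn_leq leq_card_Aut //=.
by apply: leq_card_Aut; apply: isomorphic_sym.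
Qed.

(** Use the first bijection on layer 0 and the second on layer 1. *)
Lemma isomorphic_bdc (G H : sgraph) :
  twofold_isomorphic G H -> isomorphic (bdc G) (bdc H).
Proof.
move=> [p [q [[p' pK p'K] [q' qK q'K] Hpq]]].
exists (fun x : bdc G => ((if x.2 then q x.1 else p x.1, x.2) : bdc H)); split.
  exists (fun x : bdc H => ((if x.2 then q' x.1 else p' x.1, x.2) : bdc G)).
    by case=> v [] /=; rewrite ?pK ?qK.
  by case=> v [] /=; rewrite ?p'K ?q'K.
case=> v [] [w []] /=; rewrite /bdc_adj /= ?andbF ?andbT //.
by rewrite adj_sym Hpq adj_sym.
Qed.

Lemma isomorphic_twofold (G H : sgraph) :
  isomorphic G H -> twofold_isomorphic G H.
Proof. by move=> [f [bf Hf]]; exists f, f. Qed.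

(** * Layers and automorphisms of the double cover *)

Lemma connected_eq_const (G : sgraph) (c : G -> bool) :
  connected G -> (forall v w, adj v w -> c v = c w) -> forall v w, c v = c w.
Proof. by move=> Gc Hc v w; apply: (closed_connect (a := c) Hc (Gc v w)). Qed.

(* The double cover is connected: d (v,0) (+) d (v,1) is constant in v, and if
   it were true then v |-> d (v,0) would be a proper 2-colouring of G. *)
Lemma bdc_eq_const (G : sgraph) (d : bdc G -> bool) :
    connected G -> ~ bipartite G ->
  (forall x y, adj x y -> d x = d y) -> forall x y, d x = d y.
Proof.
move=> Gc Gnb Hd.
have Hft v w : adj v w -> d (v, false) = d (w, true).
  by move=> vw; apply: Hd; rewrite /= /bdc_adj /= vw.
have He v w : d (v, false) (+) d (v, true) = d (w, false) (+) d (w, true).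
  move: v w; apply: (connected_eq_const Gc) => v w vw.
  rewrite (Hft _ _ vw) addbC; congr (_ (+) _).
  by rewrite -(Hft w) // adj_sym.
case: (pickP (fun v => d (v, false) (+) d (v, true))) => [v0 Hv0 | H0].
  case: Gnb; exists (fun v => d (v, false)) => v w vw.
  have := He w v0; rewrite Hv0 (Hft _ _ vw).
  by case: (d (w, false)) (d (w, true)) => [] [].
have E v : d (v, true) = d (v, false).
  by have := H0 v; case: (d (v, true)) (d (v, false)) => [] [].
have Hf : forall v w, d (v, false) = d (w, false).
  by apply: (connected_eq_const Gc) => v w vw; rewrite (Hft _ _ vw) E.
by case=> v [] [w []]; rewrite ?E; apply: Hf.
Qed.

(** An edge and its image both join different layers, so the layer shift of [h] is constant along
    edges, hence everywhere by [bdc_eq_const]. *)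
Lemma Aut_bdc_layer (G : sgraph) (h : {perm bdc G}) :
    connected G -> ~ bipartite G -> h \in Aut_graph (bdc G) ->
  exists b, forall x, (h x).2 = x.2 (+) b.
Proof.
move=> Gc Gnb /Aut_setP Hh.
have Hc : forall x y : bdc G, (h x).2 (+) x.2 = (h y).2 (+) y.2.
  apply: bdc_eq_const => // x y xy.
  have := xy; rewrite -Hh => /andP[_]; case/andP: xy => _.
  by case: (h x).2 x.2 (h y).2 y.2 => [] [] [] [].
case: (pickP (fun x : bdc G => true)) => [x0 _ | H0].
  exists ((h x0).2 (+) x0.2) => x; rewrite -(Hc x).
  by case: (h x).2 x.2 => [] [].
by exists false => x; have := H0 x.
Qed.

Lemma not_bipartite_vertex (G : sgraph) : ~ bipartite G -> exists v : G, true.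
Proof.
move=> Gnb; case: (pickP (fun v : G => true)) => [v _ | H0]; first by exists v.
by case: Gnb; exists (fun=> true) => v; have := H0 v.
Qed.

(** A nonbipartite graph has a vertex, so an involutive map exchanging the layers is not the
    identity and has order exactly two. *)
Lemma strongly_switchingP (G : sgraph) (g : {perm bdc G}) :
    ~ bipartite G ->
  reflect [/\ g \in Aut_graph (bdc G), involutive g,
              forall x, (g x).2 = ~~ x.2 & forall x, ~~ adj x (g x)]
          (strongly_switching g).
Proof.
move=> Gnb; apply: (iffP idP).
  case/and5P=> gA /eqP og /eqP gf /eqP gt /forallP gn; split=> //.
    by move=> x; rewrite -permM -expg2 -og expg_order perm1.
  move=> x; case E: x.2.
    have: g x \in layer G false by rewrite -gt imset_f // inE E.
    by rewrite inE => /eqP.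
  have: g x \in layer G true by rewrite -gf imset_f // inE E.
  by rewrite inE => /eqP.
case=> gA gK gl gn.
have gim i : g @: layer G i = layer G (~~ i).
  apply/setP => y; apply/imsetP/idP => [[x] | ].
    by rewrite !inE => /eqP <- ->; rewrite gl.
  rewrite inE => /eqP yi; exists (g y); last by rewrite gK.
  by rewrite inE gl yi negbK.
apply/and5P; split=> //; rewrite ?gim //; last exact/forallP.
have g2 : (g ^+ 2 = 1)%g by apply/permP => x; rewrite expg2 permM gK perm1.
have g1 : #[g]%g != 1.
  rewrite order_eq1; apply/eqP => g1; case: (not_bipartite_vertex Gnb) => v _.
  by have := gl (v, true); rewrite g1 perm1.
by apply/eqP/prime_nt_dvdP => //; rewrite order_dvdn g2.
Qed.

(** One such element thus puts its whole conjugacy class in the family. The layer shift of [h]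
    cancels under conjugation. *)
Lemma strongly_switchingJ (G : sgraph) (g h : {perm bdc G}) :
    connected G -> ~ bipartite G -> h \in Aut_graph (bdc G) ->
  strongly_switching g -> strongly_switching (g ^ h)%g.
Proof.
move=> Gc Gnb hA /(strongly_switchingP _ Gnb)[gA gK gl gn].
have [b hb] := Aut_bdc_layer Gc Gnb hA.
apply/strongly_switchingP => //.
have hx x : exists y, x = h y by exists ((h^-1)%g x); rewrite permKV.
split; first by rewrite groupJ.
- by move=> x; have [y ->] := hx x; rewrite !permJ gK.
- by move=> x; have [y ->] := hx x; rewrite permJ !hb gl addNb.
- by move=> x; have [y ->] := hx x; rewrite permJ (adj_Aut hA).
Qed.

(** * The graph of a strongly switching element *)

Section SwitchGraph.
Variables (G : sgraph) (g : {perm bdc G}).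

(* The guard makes the graph total in [g]: it is edgeless otherwise. *)
Definition switch_adj : rel G := fun v w =>
  strongly_switching g && adj ((v, false) : bdc G) (g (w, false)).

Lemma switch_adj_sym : symmetric switch_adj.
Proof.
move=> v w; rewrite /switch_adj; case: (boolP (strongly_switching g)) => //=.
case/and5P=> /Aut_setP gA /eqP og _ _ _.
have gK x : g (g x) = x by rewrite -permM -expg2 -og expg_order perm1.
(* Applying the involution [g] to both ends exchanges the roles of [v] and [w]. *)
by rewrite -/(@adj (bdc G) _ _) -[LHS]gA gK; apply: bdc_adj_sym.
Qed.

Lemma switch_adj_irrefl : irreflexive switch_adj.
Proof.
move=> v; rewrite /switch_adj; case: (boolP (strongly_switching g)) => //=.
by case/and5P=> _ _ _ _ /forallP /(_ (v, false)) /negbTE.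
Qed.

Definition switch_graph : sgraph := SGraph switch_adj_sym switch_adj_irrefl.

End SwitchGraph.

(** The two bijections are the identity and the map that [g] induces from layer 1 to layer 0. *)
Lemma twofold_switch_graph (G : sgraph) (g : {perm bdc G}) :
  ~ bipartite G -> strongly_switching g ->
  twofold_isomorphic G (switch_graph g).
Proof.
move=> Gnb gS; have [gA gK gl gn] := strongly_switchingP _ Gnb gS.
have gE i v : g (v, i) = ((g (v, i)).1, ~~ i).
  by rewrite [LHS]surjective_pairing gl.
exists id, (fun v => (g (v, true)).1); split; first by exists id.
  exists (fun v => (g (v, false)).1) => v.
    by rewrite -[((g (v, true)).1, false)](gE true) gK.
  by rewrite -[((g (v, false)).1, true)](gE false) gK.
move=> v w; rewrite /= /switch_adj gS /=.
by rewrite -[((g (w, true)).1, false)](gE true) gK /bdc_adj /= andbT.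
Qed.

(** * Lifting graph isomorphisms to the double cover *)

Section SwitchLift.
Variables (G : sgraph) (g g' : {perm bdc G}) (f : G -> G).
Hypothesis Gnb : ~ bipartite G.
Hypotheses (gS : strongly_switching g) (gS' : strongly_switching g').
Hypothesis f_inj : injective f.

(** The only extension of [f] from layer 0 that can intertwine [g] with [g']: a vertex [x] of layer
    1 is the image under [g] of [g x], which lies in layer 0. *)
Definition switch_lift_fun (x : bdc G) : bdc G :=
  if x.2 then g' (f (g x).1, false) else (f x.1, false).

Lemma switch_lift_fun_inj : injective switch_lift_fun.
Proof.
have [_ _ gl _] := strongly_switchingP _ Gnb gS.
have [_ _ gl' _] := strongly_switchingP _ Gnb gS'.
move=> [v i] [w j]; rewrite /switch_lift_fun /=; case: i j => [] [].
- move=> /perm_inj [] /f_inj E; apply: (@perm_inj _ g).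
  by rewrite [LHS]surjective_pairing [RHS]surjective_pairing E !gl.
- by move/(congr1 snd); rewrite gl'.
- by move/(congr1 snd); rewrite gl'.
- by case=> /f_inj ->.
Qed.

Definition switch_lift : {perm bdc G} := perm switch_lift_fun_inj.

Lemma switch_lift_false v : switch_lift (v, false) = (f v, false).
Proof. by rewrite permE. Qed.

Lemma switch_lift_comm x : switch_lift (g x) = g' (switch_lift x).
Proof.
have [_ gK gl _] := strongly_switchingP _ Gnb gS.
have [_ gK' _ _] := strongly_switchingP _ Gnb gS'.
rewrite !permE /switch_lift_fun gl gK.
by case: x => v [] //=; rewrite gK'.
Qed.

Lemma switch_lift_layer x : (switch_lift x).2 = x.2.
Proof.
have [_ _ gl' _] := strongly_switchingP _ Gnb gS'.
by rewrite permE /switch_lift_fun; case: x => v [] //=; rewrite gl'.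
Qed.

(** Writing a layer 1 vertex as [g (u, false)] turns adjacency across the layers into adjacency in
    the switch graphs. *)
Lemma switch_lift_Aut :
    (forall v w, switch_adj g v w = switch_adj g' (f v) (f w)) ->
  switch_lift \in Aut_graph (bdc G).
Proof.
have [_ gK gl _] := strongly_switchingP _ Gnb gS.
move=> Hf.
have Hft (v w : G) :
    adj (switch_lift (v, false)) (switch_lift (w, true))
    = adj ((v, false) : bdc G) (w, true).
  pose u := (g (w, true)).1.
  have -> : (w, true) = g (u, false).
    by rewrite -[(w, true)]gK [g (w, true)]surjective_pairing gl.
  rewrite switch_lift_comm !switch_lift_false.
  by have := Hf v u; rewrite /switch_adj gS gS' /= => ->.
apply/Aut_setP => [] [v i] [w j].
have [E | ] := boolP (i == j).
  by rewrite /= /bdc_adj !switch_lift_layer /= (eqP E) eqxx !andbF.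
case: i j => [] [] // _.
by rewrite adj_sym Hft adj_sym.
Qed.

End SwitchLift.

(** An isomorphism lifts to an automorphism conjugating [g] to [g']; conversely, a layer-preserving
    conjugator restricts on layer 0 to an isomorphism. *)
Lemma isomorphic_switch_graph (G : sgraph) (g g' : {perm bdc G}) :
    connected G -> ~ bipartite G ->
    strongly_switching g -> strongly_switching g' ->
  isomorphic (switch_graph g) (switch_graph g') <->
  g' \in (g ^: Aut_graph (bdc G))%g.
Proof.
move=> Gc Gnb gS gS'; split.
  move=> [f [/bij_inj f_inj Hf]].
  apply/imsetP; exists (switch_lift Gnb gS gS' f_inj).
    exact: switch_lift_Aut.
  set h := switch_lift _ _ _ _.
  apply/permP => y; rewrite -[y](permKV h) permJ.
  by rewrite switch_lift_comm.
have [gA gK gl _] := strongly_switchingP _ Gnb gS.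
case/imsetP=> h0 h0A E0.
(* Multiplying by g, we may assume that h preserves the layers. *)
have [h hA [E hl]] : exists2 h, h \in Aut_graph (bdc G) &
    (g' = g ^ h)%g /\ forall x, (h x).2 = x.2.
  have [[] hb] := Aut_bdc_layer Gc Gnb h0A; last first.
    by exists h0 => //; split=> // x; rewrite hb addbF.
  exists (g * h0)%g; first by rewrite groupM.
  split; first by rewrite conjgM (conjgE g g) mulKg.
  by move=> x; rewrite permM hb gl addbT negbK.
pose f v := (h (v, false)).1.
have hE v : h (v, false) = (f v, false).
  by rewrite [LHS]surjective_pairing hl.
exists f; split.
  by apply: injF_bij => v w Efv; have /perm_inj[] : h (v, false) = h (w, false)
    by rewrite !hE Efv.
move=> v w; rewrite /= /switch_adj gS gS' -!hE E permJ /=.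
by have /= -> := adj_Aut hA (v, false) (g (w, false)).
Qed.

(** Each element of the centralizer is uniquely a lift of an automorphism [p] times [g ^+ b], where
    [b] records whether it exchanges the layers. *)
Lemma card_cent_switch (G : sgraph) (g : {perm bdc G}) :
    connected G -> ~ bipartite G -> strongly_switching g ->
  #|'C_(Aut_graph (bdc G))[g]%g| = 2 * #|Aut_graph (switch_graph g)|.
Proof.
move=> Gc Gnb gS; have [gA gK gl _] := strongly_switchingP _ Gnb gS.
pose lift (p : {perm G}) := switch_lift Gnb gS gS (@perm_inj _ p).
pose F (u : {perm G} * bool) := (lift u.1 * g ^+ u.2)%g.
have Fl u x : (F u x).2 = x.2 (+) u.2.
  rewrite permM; case: u => p [] /=.
    by rewrite expg1 gl switch_lift_layer addbT.
  by rewrite expg0 perm1 switch_lift_layer addbF.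
have F_inj : injective F.
  move=> [p b] [q c] E; have [v0 _] := not_bipartite_vertex Gnb.
  have Ebc : b = c.
    by have := Fl (p, b) (v0, false); rewrite E Fl.
  rewrite {}Ebc in E *; congr (_, _).
  apply/permP => v; have /mulIg /permP /(_ (v, false)) := E.
  by rewrite !switch_lift_false => -[].
rewrite -card_bool mulnC -cardsT -cardsX -(card_imset _ F_inj).
apply: eq_card => h; apply/idP/imsetP => [| [[p b] Hp ->]]; last first.
  move: Hp; rewrite in_setX in_setT andbT => /(@adj_Aut (switch_graph g)) Hp.
  have lA : lift p \in Aut_graph (bdc G).
    by apply: switch_lift_Aut => v w; have /= -> := Hp v w.
  apply/setIP; split; rewrite groupM ?groupX ?cent1id //.
  by apply/cent1P/permP => x; rewrite !permM switch_lift_comm.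
case/setIP=> hA /cent1P hg.
have [b hb] := Aut_bdc_layer Gc Gnb hA.
(* Cancel the layer exchange of [h]: the product still commutes with [g], and [p] is its restriction
   to layer 0. *)
pose h' := (h * g ^+ b)%g.
have h'A : h' \in Aut_graph (bdc G) by rewrite groupM // groupX.
have h'l x : (h' x).2 = x.2.
  rewrite /h'; case: (b) hb => hb; rewrite permM ?expg1 ?expg0 ?perm1.
    by rewrite gl hb addbT negbK.
  by rewrite hb addbF.
have h'g x : h' (g x) = g (h' x).
  rewrite -!permM; congr (fun_of_perm _ x); rewrite /h'.
  by rewrite mulgA -hg -!mulgA -expgS -expgSr.
have hE v : h' (v, false) = ((h' (v, false)).1, false).
  by rewrite [LHS]surjective_pairing h'l.
have p_inj : injective (fun v => (h' (v, false)).1).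
  move=> v w E; have /perm_inj[] // : h' (v, false) = h' (w, false).
  by rewrite hE E -hE.
pose p := perm p_inj.
have pE v : (p v, false) = h' (v, false) by rewrite permE -hE.
exists (p, b).
  rewrite in_setX in_setT andbT; apply/(@Aut_setP (switch_graph g)) => v w.
  rewrite /= /switch_adj gS /= !pE -h'g.
  exact: (adj_Aut h'A).
have g2 : (g ^+ b * g ^+ b = 1)%g.
  rewrite -expgD; case: (b) => //=; rewrite expg2.
  by apply/permP => x; rewrite permM gK perm1.
rewrite /F /=; suff -> : lift p = h' by rewrite /h' -mulgA g2 mulg1.
have Ef v : lift p (v, false) = h' (v, false).
  by rewrite switch_lift_false pE.
(* Both permutations commute with [g], so agreement on layer 0 passes to layer 1. *)
apply/permP => [] [v []] //.
rewrite -[(v, true)]gK switch_lift_comm h'g; congr (g _).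
by rewrite [g _]surjective_pairing gl /=.
Qed.

(** [g] is the layer swap of [bdc H] pulled back along [p] on layer 0 and [q] on layer 1;
    looplessness of [H] keeps each vertex nonadjacent to its image. *)
Lemma twofold_switch (G H : sgraph) :
    ~ bipartite G -> twofold_isomorphic G H ->
  exists2 g : {perm bdc G},
    strongly_switching g & isomorphic (switch_graph g) H.
Proof.
move=> Gnb [p [q [[p' pK p'K] [q' qK q'K] Hpq]]].
pose gf (x : bdc G) : bdc G := if x.2 then (p' (q x.1), false)
                               else (q' (p x.1), true).
have gfK : involutive gf by case=> v []; rewrite /gf /= ?p'K ?q'K ?qK ?pK.
pose g := perm (inv_inj gfK).
have gS : strongly_switching g.
  apply/strongly_switchingP => //; split.
  - apply/Aut_setP => [] [v i] [w j]; rewrite !permE.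
    case: i j => [] []; rewrite /gf /= /bdc_adj /= ?andbF // !andbT.
      by rewrite [RHS]adj_sym !Hpq p'K q'K adj_sym.
    by rewrite [LHS]adj_sym !Hpq p'K q'K adj_sym.
  - by move=> x; rewrite !permE gfK.
  - by case=> v []; rewrite permE.
  - case=> v [] ; rewrite permE /gf /= /bdc_adj /= andbT.
      by rewrite adj_sym Hpq p'K adj_irrefl.
    by rewrite Hpq q'K adj_irrefl.
exists g => //; exists p; split; first by exists p'.
move=> v w; rewrite /= /switch_adj gS permE /gf /= /bdc_adj /= andbT.
by rewrite Hpq q'K.
Qed.

(** * The bijection through class representatives, and the class sizes *)

Theorem theorem8p6 (G : sgraph) (Gconn : connected G) (Gred : reduced G)
    (Gnbip : ~ bipartite G) :
  exists psi : {set {perm (bdc G)}} -> (sgraph -> Prop),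
    bijection_onto (strongly_switching_classes G) (twofold_iso_classes G) psi /\
    (forall C : {set {perm (bdc G)}},
       C \in strongly_switching_classes G ->
       forall H : sgraph, psi C H -> (#|C|%:R = Inst H :> rat)%R).
Proof.
have reprC C : C \in strongly_switching_classes G ->
    strongly_switching (repr C) /\ C = (repr C ^: Aut_graph (bdc G))%g.
  rewrite inE => /andP[/imsetP[g gA ->]] /forall_inP CS.
  have gC := mem_repr g (class_refl (Aut_graph (bdc G)) g).
  by split; [apply: CS | apply/esym/class_eqP].
exists (fun C => iso_class (switch_graph (repr C))); split; first split.
- move=> C /reprC[gS _]; exists (switch_graph (repr C)).
  by split=> //; apply: twofold_switch_graph.
- move=> C D /reprC[gS EC] /reprC[gS' ED] /iso_class_eq.
  move/isomorphic_switch_graph => /(_ Gconn Gnbip gS gS') /class_eqP E.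
  by rewrite EC ED E.
- move=> _ [H [GH ->]]; have [g gS gH] := twofold_switch Gnbip GH.
  have CS : (g ^: Aut_graph (bdc G))%g \in strongly_switching_classes G.
    rewrite inE mem_classes /=; last by case/and5P: gS.
    by apply/forall_inP => _ /imsetP[h hA ->]; apply: strongly_switchingJ.
  exists (g ^: Aut_graph (bdc G))%g => //; apply/iso_class_eq.
  apply: (isomorphic_trans _ gH); have [rS rC] := reprC _ CS.
  by apply/isomorphic_switch_graph => //; rewrite -rC class_refl.
move=> C /reprC[gS EC] H iH; move: (repr C) gS EC iH => g gS -> iH.
have GB : #|Aut_graph (bdc G)| = #|Aut_graph (bdc H)|.
  transitivity #|Aut_graph (bdc (switch_graph g))|.
    apply/card_Aut_isomorphic/isomorphic_bdc; exact: twofold_switch_graph.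
  by apply/card_Aut_isomorphic/isomorphic_bdc/isomorphic_twofold.
(* The class size is the index of the centralizer of [g], whose order is twice that of
   [Aut_graph H]. *)
rewrite /Inst -GB -(card_Aut_isomorphic iH) -natrM.
rewrite -card_cent_switch // -index_cent1.
rewrite -(Lagrange (subsetIl (Aut_graph (bdc G)) 'C[g]%g)) natrM mulrC mulKf //.
by rewrite pnatr_eq0 -lt0n cardG_gt0.
Qed.
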